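(* Let $\ell, n$ be positive integers with $\ell \leq n$. If $S$ is a subgroup of $S_\ell$, then $\operatorname{Comp}^{(n)} S$ is a subgroup of $S_n$.
   Context: $[n] := \{1,\dots,n\}$ and $S_n$ is the symmetric group of all permutations of $[n]$, with composition of functions from right to left. For an $\ell$-element subset $I \subseteq [n]$, let $h_I \colon [\ell] \to I$ be the unique order-isomorphism (with respect to the usual order of integers). For $\pi \in S_n$ define $\pi_I := h_{\pi(I)}^{-1} \circ \pi|_I \circ h_I \in S_\ell$, where $\pi(I) = \{\pi(a) \mid a \in I\}$. The set of $\ell$-patterns of $\pi$ is $\operatorname{Pat}^{(\ell)} \pi := \{\pi_I \mid I \subseteq [n],\ |I| = \ell\} \subseteq S_\ell$. For $S \subseteq S_\ell$, $\operatorname{Comp}^{(n)} S := \{\tau \in S_n \mid \operatorname{Pat}^{(\ell)} \tau \subseteq S\}$. *)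

(* Defs.v *)
(* The set [n] is rendered as 'I_n = {0, ..., n-1}. MathComp
   composes permutations from left to right, (s * t) x = t (s x), so 'S_n below
   is the opposite group of the one with right-to-left composition; the two
   have exactly the same subgroups. *)
From mathcomp Require Import all_boot all_fingroup.

Set Implicit Arguments.
Unset Strict Implicit.
Unset Printing Implicit Defensive.

Definition ksubset (n l : nat) := {I : {set 'I_n} | #|I| == l}.

Section Patterns.

Variables n l : nat.
Implicit Types (I : ksubset n l) (p : 'S_n).

Lemma card_ksubset I : #|val I| = l.
Proof. exact/eqP/(valP I). Qed.

(* h_I : [l] -> I, viewed as a map into [n]: enum lists I increasingly, see
   order_iso_in, order_iso_img and order_iso_mono below. *)
Definition order_iso I (i : 'I_l) : 'I_n :=
  enum_val (cast_ord (esym (card_ksubset I)) i).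

Lemma order_iso_in I i : order_iso I i \in val I.
Proof. exact: enum_valP. Qed.

Lemma order_iso_inj I : injective (order_iso I).
Proof. by move=> i j /enum_val_inj /cast_ord_inj. Qed.

Lemma order_iso_img I : order_iso I @: setT = val I.
Proof.
apply/eqP; rewrite eqEcard card_imset ?cardsT ?card_ord ?card_ksubset ?leqnn;
  last exact: order_iso_inj.
by rewrite andbT; apply/subsetP=> _ /imsetP[i _ ->]; apply: order_iso_in.
Qed.

Lemma order_iso_mono I (i j : 'I_l) :
  (order_iso I i < order_iso I j) = (i < j).
Proof.
have homo (a b : 'I_l) : a < b -> order_iso I a < order_iso I b.
  move=> lt_ab; have x0 := order_iso I a; rewrite /order_iso !(enum_val_nth x0) /=.
  have srt : sorted ltn (map val (enum (val I))).
    rewrite {1}/enum_mem -enumT; apply: (subseq_sorted ltn_trans (s2 := iota 0 n)).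
      by rewrite -val_enum_ord map_subseq ?filter_subseq.
    exact: iota_ltn_sorted.
  have sz (c : 'I_l) : c < size (enum (val I)).
    by rewrite -cardE card_ksubset.
  rewrite -!(nth_map x0 (val x0) val) //.
  by apply: (sorted_ltn_nth ltn_trans) => //; rewrite inE size_map.
case: (ltngtP i j) => [/homo //|/homo /ltnW|/val_inj ->]; last by rewrite ltnn.
by rewrite ltnNge => ->.
Qed.

(* h_I^-1 : I -> [l]; the index i0 only makes [l] nonempty, so that the map can
   be given a junk value outside I; see order_isoK and order_iso_invK. *)
Definition order_iso_inv I (i0 : 'I_l) (x : 'I_n) : 'I_l :=
  cast_ord (card_ksubset I) (enum_rank_in (order_iso_in I i0) x).

Lemma order_isoK I i0 : cancel (order_iso I) (order_iso_inv I i0).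
Proof.
move=> i; rewrite /order_iso_inv /order_iso enum_valK_in.
exact: (cast_ordKV (card_ksubset I)).
Qed.

Lemma order_iso_invK I i0 :
  {in val I, cancel (order_iso_inv I i0) (order_iso I)}.
Proof. by move=> x Ix; rewrite /order_iso /order_iso_inv cast_ordK enum_rankK_in. Qed.

Lemma ksubset_img_subproof p I : #|p @: val I| == l.
Proof. by rewrite card_imset ?card_ksubset //; apply: perm_inj. Qed.

Definition ksubset_img p I : ksubset n l :=
  exist _ (p @: val I) (ksubset_img_subproof p I).

Definition pattern_fun p I (i : 'I_l) : 'I_l :=
  order_iso_inv (ksubset_img p I) i (p (order_iso I i)).

Lemma pattern_funE p I i :
  order_iso (ksubset_img p I) (pattern_fun p I i) = p (order_iso I i).
Proof. by rewrite order_iso_invK //= imset_f // order_iso_in. Qed.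

Lemma pattern_fun_inj p I : injective (pattern_fun p I).
Proof.
move=> i j /(congr1 (order_iso (ksubset_img p I))).
by rewrite !pattern_funE => /perm_inj /order_iso_inj.
Qed.

Definition pattern p I : 'S_l := perm (@pattern_fun_inj p I).

End Patterns.

Definition Pat (n l : nat) (p : 'S_n) : {set 'S_l} :=
  [set pattern p I | I : ksubset n l].

Definition Comp (n l : nat) (S : {set 'S_l}) : {set 'S_n} :=
  [set t : 'S_n | Pat l t \subset S].

(* Main.v *)
Require Import Defs.
From mathcomp Require Import all_boot all_fingroup.

(** Patterns obey a cocycle rule ([patternM]): the pattern of [s * t] at [I] is that of [s] at [I]
    times that of [t] at the image of [I] under [s]. If all patterns of [s] and [t] lie in the group
    [S], so do those of [s * t]. *)

Lemma pattern1 (n l : nat) (I : ksubset n l) : pattern 1%g I = 1%g.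
Proof.
apply/permP=> i; rewrite perm1 permE.
apply: (@order_iso_inj _ _ (ksubset_img 1%g I)).
rewrite pattern_funE perm1; congr (order_iso _ i); apply: val_inj => /=.
by rewrite (eq_imset _ (@perm1 _)) imset_id.
Qed.

(** The order isomorphism onto the intermediate set [s @: I] cancels against its inverse. *)
Lemma patternM (n l : nat) (s t : 'S_n) (I : ksubset n l) :
  pattern (s * t)%g I = (pattern s I * pattern t (ksubset_img s I))%g.
Proof.
have imgM : ksubset_img (s * t)%g I = ksubset_img t (ksubset_img s I).
  by apply: val_inj; rewrite /= -imset_comp; apply: eq_imset => x; rewrite permM.
apply/permP=> i; rewrite permM !permE.
(* Compare after embedding back into ['I_n], where [pattern_funE] removes the inverse
   isomorphisms. *)
apply: (@order_iso_inj _ _ (ksubset_img (s * t)%g I)).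
by rewrite pattern_funE imgM !pattern_funE permM.
Qed.

Lemma in_Comp (n l : nat) (S : {set 'S_l}) (t : 'S_n) :
  reflect (forall I : ksubset n l, pattern t I \in S) (t \in Comp n S).
Proof.
rewrite inE; apply: (iffP subsetP) => [sS I | inS _ /imsetP[I _ ->] //].
by apply: sS; apply: imset_f.
Qed.

Theorem proposition3p1 (l n : nat) (l_gt0 : 0 < l) (n_gt0 : 0 < n)
  (le_ln : l <= n) (S : {group 'S_l}) : group_set (Comp n S).
Proof.
(* Finiteness makes closure under inverses automatic. *)
apply/group_setP; split=> [|s t /in_Comp Ss /in_Comp St]; apply/in_Comp=> I.
  by rewrite pattern1 group1.
by rewrite patternM groupM.
Qed.
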